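(* Let $D=(E,\mathcal F)$ be a proper set system. Then there exists a feasible set $F\in\mathcal F$ such that $$\omega(D^{\ast\times\ast|F})=\max_{B\subseteq E}\omega(D^{\ast\times\ast|B}).$$
   Context: A set system is a pair $D=(E,\mathcal F)$ with $E$ a finite set and $\mathcal F\subseteq 2^E$; the members of $\mathcal F$ are the feasible sets of $D$, also denoted $\mathcal F(D)$. $D$ is proper if $\mathcal F\neq\emptyset$. For proper $D$, $r(D_{\max})$ and $r(D_{\min})$ denote the largest and smallest cardinality of a feasible set, and the width is $\omega(D)=r(D_{\max})-r(D_{\min})$. Twist: for $A\subseteq E$, $D^{\ast|A}=(E,\{F\triangle A\mid F\in\mathcal F\})$, where $\triangle$ is symmetric difference. Loop complementation: for $e\in E$, $D^{\times|e}=(E,\mathcal F')$ with $\mathcal F'=\mathcal F\,\triangle\,\{F\cup\{e\}\mid F\in\mathcal F,\ e\notin F\}$. Loop complementations on distinct elements commute, and for $A\subseteq E$, $D^{\times|A}$ is obtained by applying loop complementation to every element of $A$. These operations preserve properness. Words are read left to right: $D^{\ast\times\ast|A}=((D^{\ast|A})^{\times|A})^{\ast|A}$. *)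

(* Defs.v *)
From mathcomp Require Import all_boot.

Set Implicit Arguments.
Unset Strict Implicit.
Unset Printing Implicit Defensive.

(* A set system (E, F) is given by its ground set, a finType E, and its
   collection of feasible sets D : {set {set E}}. *)

Definition symdiff (T : finType) (A B : {set T}) : {set T} :=
  (A :\: B) :|: (B :\: A).

Definition proper_system (E : finType) (D : {set {set E}}) : bool := D != set0.

Definition twist (E : finType) (D : {set {set E}}) (A : {set E}) :
    {set {set E}} :=
  [set symdiff F A | F in D].

Definition loop_compl1 (E : finType) (D : {set {set E}}) (e : E) :
    {set {set E}} :=
  symdiff D [set e |: F | F in D & e \notin F].

(* The order given by enum is immaterial, see loop_compl_perm. *)
Definition loop_compl (E : finType) (D : {set {set E}}) (A : {set E}) :
    {set {set E}} :=
  foldl (@loop_compl1 E) D (enum A).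

Definition twist_loop_twist (E : finType) (D : {set {set E}}) (A : {set E}) :
    {set {set E}} :=
  twist (loop_compl (twist D A) A) A.

Definition rmax (E : finType) (D : {set {set E}}) : nat :=
  \max_(F in D) #|F|.

(* No feasible set has more than #|E| elements, so the neutral element #|E|
   does not affect the minimum when D is proper. *)
Definition rmin (E : finType) (D : {set {set E}}) : nat :=
  \big[minn/#|E|]_(F in D) #|F|.

(* The subtraction does not truncate when D is proper, see rmin_le_rmax. *)
Definition width (E : finType) (D : {set {set E}}) : nat := rmax D - rmin D.

Lemma in_symdiff (T : finType) (A B : {set T}) x :
  (x \in symdiff A B) = (x \in A) (+) (x \in B).
Proof. by rewrite !inE; case: (x \in A); case: (x \in B). Qed.

Lemma in_loop_compl1 (E : finType) (D : {set {set E}}) e X :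
  (X \in loop_compl1 D e) = (X \in D) (+) ((e \in X) && (X :\ e \in D)).
Proof.
rewrite in_symdiff; congr (_ (+) _); apply/imsetP/andP.
  case=> F; rewrite inE => /andP[FD eF] ->; split; first by rewrite setU11.
  by rewrite setU1K.
by case=> eX XD; exists (X :\ e); rewrite ?setD1K // inE XD setD11.
Qed.

Lemma loop_compl1C (E : finType) (D : {set {set E}}) e f :
  loop_compl1 (loop_compl1 D e) f = loop_compl1 (loop_compl1 D f) e.
Proof.
apply/setP=> X; rewrite !in_loop_compl1 !in_setD1.
have [-> //|nef] := eqVneq e f.
rewrite [X :\ f :\ e]setDDl setUC -setDDl /=.
by case: (e \in X); case: (f \in X); case: (X \in D); case: (X :\ e \in D);
   case: (X :\ f \in D); case: (X :\ e :\ f \in D).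
Qed.

Lemma loop_compl_perm (E : finType) (D : {set {set E}}) (A : {set E}) s :
  perm_eq s (enum A) -> foldl (@loop_compl1 E) D s = loop_compl D A.
Proof.
rewrite /loop_compl; move: (enum A) => t.
elim: s t D => [|e s IHs] t D; first by rewrite perm_sym => /perm_nilP->.
move=> est; have et : e \in t by rewrite -(perm_mem est) mem_head.
have /IHs IH : perm_eq s (rem e t).
  by rewrite -(perm_cons e); apply: perm_trans est (perm_to_rem et).
rewrite /= IH {est IHs IH}.
elim: t D et => //= f t IHt D; rewrite inE eq_sym.
by case: eqP => [-> //|_ /= et]; rewrite loop_compl1C IHt.
Qed.

Lemma rmin_le_rmax (E : finType) (D : {set {set E}}) :
  proper_system D -> rmin D <= rmax D.
Proof.
case/set0Pn=> F FD; apply: (@leq_trans #|F|); last exact: leq_bigmax_cond.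
rewrite /rmin; elim: (index_enum _) (mem_index_enum F) => //= G r IHr.
rewrite inE big_cons => /predU1P[<-|/IHr rF]; first by rewrite FD geq_minl.
by case: ifP => // _; rewrite geq_min rF orbT.
Qed.

(* Main.v *)
(** A set X is feasible in D^{*x*|B} iff an odd number of feasible sets F of D
    satisfy X \subset F \subset X :|: B.  Hence the largest size of a feasible
    set does not depend on B.  If X is feasible in D^{*x*|B} for some B, some
    feasible set of D contains X; let F be one of least size.  Then F is the
    only feasible set between X and X :|: F = F, so X is also feasible in
    D^{*x*|F}.  Applying this to a smallest feasible X for an optimal B
    gives the theorem. *)

Require Import Defs.
From mathcomp Require Import all_boot.

Lemma symdiffK {T : finType} (A : {set T}) : involutive (@symdiff T ^~ A).
Proof. by move=> X; apply/setP=> x; rewrite !in_symdiff addbK. Qed.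

Lemma in_twist {E : finType} (D : {set {set E}}) (A X : {set E}) :
  (X \in twist D A) = (symdiff X A \in D).
Proof.
apply/imsetP/idP=> [[F FD ->]|XD]; first by rewrite symdiffK.
by exists (symdiff X A); rewrite ?symdiffK.
Qed.

(** Modulo 2, each loop complementation adds the count for [X :\ e] to the one for [X]. Allowing any
    duplicate-free list, not just [enum A], permits induction on its last element. *)
Lemma in_foldl_loop_compl1 {E : finType} (D : {set {set E}}) (s : seq E)
    (X : {set E}) :
  uniq s ->
  (X \in foldl (@loop_compl1 E) D s) =
    odd #|[set Y in D | (X :\: [set:: s] \subset Y) && (Y \subset X)]|.
Proof.
elim/last_ind: s X => [|s e IHs] X /=.
  move=> _; case XD: (X \in D).
    rewrite (_ : [set Y in D | _] = [set X]) ?cards1 //.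
    apply/setP=> Y; rewrite !inE set_nil setD0 -eqEsubset [X == Y]eq_sym.
    by case: eqP => [->|_]; rewrite ?XD ?andbF.
  rewrite (_ : [set Y in D | _] = set0) ?cards0 //.
  apply/setP=> Y; rewrite !inE set_nil setD0 -eqEsubset.
  by case: eqP => [<-|_]; rewrite ?XD ?andbF.
rewrite rcons_uniq => /andP[es us].
rewrite foldl_rcons in_loop_compl1 !IHs //.
case eX: (e \in X) => /=; last first.
  rewrite addbF; suff -> : X :\: [set:: rcons s e] = X :\: [set:: s] by [].
  apply/setP=> x; rewrite !inE mem_rcons inE.
  by case: eqP => [->|]; rewrite ?eX ?andbF.
(* Split the counted sets by whether they contain [e]. As [e] is in [X] but not in [s], each set
   above [X :\: [set:: s]] contains [e], so the first class is the count for [X]; the second is the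
   count for [X :\ e]. *)
rewrite -oddD -[in RHS](cardsID [set Y : {set E} | e \in Y]).
congr (odd (_ + _)); congr #|pred_of_set _|; apply/setP=> Y; rewrite !inE.
  rewrite -!andbA; congr (_ && _); rewrite [RHS]andbCA [LHS]andbC.
  congr (_ && _).
  apply/subsetP/andP=> [sXY|[/subsetP sXY eY] x].
    split; last by apply: sXY; rewrite !inE eX es.
    apply/subsetP=> x; rewrite !inE mem_rcons inE negb_or -andbA.
    by move=> /and3P[_ xs xX]; apply: sXY; rewrite !inE xs xX.
  rewrite !inE => /andP[xs xX]; have [-> //|ne] := eqVneq x e.
  by apply: sXY; rewrite !inE mem_rcons inE negb_or ne xs.
suff -> : X :\ e :\: [set:: s] = X :\: [set:: rcons s e].
  by rewrite subsetD1; case: (e \in Y); rewrite ?andbF ?andbT.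
by apply/setP=> x; rewrite !inE mem_rcons inE negb_or andbCA andbA.
Qed.

(** The map [symdiff ^~ A] carries the sets counted for the loop complement to those counted here:
    outside [A] both conditions force [Y] to agree with [X], and inside [A] complementation reverses
    inclusion, leaving only that [Y] contains [X] there. *)
Lemma in_twist_loop_twist {E : finType} (D : {set {set E}}) (A X : {set E}) :
  (X \in twist_loop_twist D A) =
    odd #|[set Y in D | (X \subset Y) && (Y \subset X :|: A)]|.
Proof.
rewrite in_twist in_foldl_loop_compl1 ?enum_uniq //.
rewrite -(card_imset _ (inv_inj (symdiffK A))).
congr (odd #|pred_of_set _|); apply/setP=> Y.
transitivity (symdiff Y A \in [set Z in twist D A |
   (symdiff X A :\: [set:: enum A] \subset Z) && (Z \subset symdiff X A)]).
  apply/imsetP/idP=> [[Z ZD ->]|YD]; first by rewrite symdiffK.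
  by exists (symdiff Y A); rewrite ?symdiffK.
rewrite !inE in_twist symdiffK; congr (_ && _).
apply/andP/andP=> -[/subsetP s1 /subsetP s2]; split; apply/subsetP=> x;
  move: (s1 x) (s2 x); rewrite !(in_symdiff, inE, mem_enum);
  by case: (x \in A); case: (x \in X); case: (x \in Y) => //= *; auto.
Qed.

Lemma rmin_le {E : finType} (D : {set {set E}}) (F : {set E}) :
  F \in D -> rmin D <= #|F|.
Proof.
move=> FD; rewrite /rmin.
elim: (index_enum _) (mem_index_enum F) => //= G r IHr.
rewrite inE big_cons => /predU1P[<-|/IHr rF]; first by rewrite FD geq_minl.
by case: ifP => // _; rewrite geq_min rF orbT.
Qed.

Lemma rmin_attained {E : finType} {D : {set {set E}}} :
  proper_system D -> exists2 F, F \in D & #|F| = rmin D.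
Proof.
case/set0Pn=> F0 F0D.
case: (arg_minnP (fun F : {set E} => #|F|) F0D) => F FD Fmin.
exists F => //; apply/eqP; rewrite eqn_leq rmin_le // andbT.
(* The bound must also hold for the neutral element [#|E|] of the minimum. *)
apply: (big_ind (fun n => #|F| <= n)) => [|m n|]; last exact: Fmin.
  exact: max_card.
by rewrite leq_min => -> ->.
Qed.

(** A largest feasible set is the only feasible set containing itself, so the count is 1 whatever
    [B] is. *)
Lemma mem_twist_loop_twist_largest {E : finType} {D : {set {set E}}}
    (B : {set E}) {F : {set E}} :
  F \in D -> (forall G, G \in D -> #|G| <= #|F|) -> F \in twist_loop_twist D B.
Proof.
move=> FD Fmax; rewrite in_twist_loop_twist.
rewrite (_ : [set Y in D | _] = [set F]) ?cards1 //.
apply/setP=> Y; rewrite !inE; apply/and3P/eqP=> [[YD FY _]|->].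
  by apply/esym/eqP; rewrite eqEcard FY Fmax.
by split=> //; apply: subsetUl.
Qed.

Lemma twist_loop_twist_sub_feasible {E : finType} {D : {set {set E}}}
    {B X : {set E}} :
  X \in twist_loop_twist D B -> exists2 F, F \in D & X \subset F.
Proof.
rewrite in_twist_loop_twist => /odd_gt0; rewrite card_gt0 => /set0Pn[F].
by rewrite inE => /and3P[FD XF _]; exists F.
Qed.

Lemma twist_loop_twist_feasible {E : finType} {D : {set {set E}}}
    {B X : {set E}} :
  X \in twist_loop_twist D B -> exists2 F, F \in D & X \in twist_loop_twist D F.
Proof.
case/twist_loop_twist_sub_feasible=> F0 F0D XF0.
have P0 : [pred F : {set E} | (F \in D) && (X \subset F)] F0 by rewrite /= F0D.
case: (arg_minnP (fun F : {set E} => #|F|) P0) => F /andP[FD XF] Fmin.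
exists F => //; rewrite in_twist_loop_twist (setUidPr XF).
rewrite (_ : [set Y in D | _] = [set F]) ?cards1 //.
apply/setP=> Y; rewrite !inE; apply/and3P/eqP=> [[YD XY YF]|-> //].
by apply/eqP; rewrite eqEcard YF Fmin //= YD.
Qed.

Lemma exists_largest_feasible {E : finType} {D : {set {set E}}} :
  proper_system D ->
  exists2 F, F \in D & forall G, G \in D -> #|G| <= #|F|.
Proof.
case/set0Pn=> F0 F0D.
case: (arg_maxnP (fun F : {set E} => #|F|) F0D) => F FD Fmax.
by exists F.
Qed.

Lemma proper_twist_loop_twist {E : finType} {D : {set {set E}}} (B : {set E}) :
  proper_system D -> proper_system (twist_loop_twist D B).
Proof.
case/exists_largest_feasible=> F FD Fmax.
by apply/set0Pn; exists F; apply: mem_twist_loop_twist_largest.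
Qed.

(** New feasible sets lie inside feasible sets of [D], and a largest one of [D] survives. *)
Lemma rmax_twist_loop_twist {E : finType} {D : {set {set E}}} (B : {set E}) :
  proper_system D -> rmax (twist_loop_twist D B) = rmax D.
Proof.
case/exists_largest_feasible=> F FD Fmax.
apply/eqP; rewrite eqn_leq; apply/andP; split.
  apply/bigmax_leqP=> X /twist_loop_twist_sub_feasible[G GD XG].
  by apply: leq_trans (subset_leq_card XG) _; apply: leq_bigmax_cond.
have FB := mem_twist_loop_twist_largest B FD Fmax.
by apply: (@leq_trans #|F|); [apply/bigmax_leqP | apply: leq_bigmax_cond].
Qed.

Theorem theorem3p3 (E : finType) (D : {set {set E}}) :
  proper_system D ->
  exists2 F : {set E}, F \in D &
    width (twist_loop_twist D F) =
      \max_(B : {set E}) width (twist_loop_twist D B).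
Proof.
move=> Dp.
have [|B wB] := @eq_bigmax {set E} (fun B => width (twist_loop_twist D B)).
  by apply/card_gt0P; exists set0.
have [X XB cX] := rmin_attained (proper_twist_loop_twist B Dp).
have [F FD XF] := twist_loop_twist_feasible XB.
exists F => //; apply/eqP; rewrite eqn_leq; apply/andP; split.
  exact: (leq_bigmax (F := fun C => width (twist_loop_twist D C))).
rewrite wB.
(* The maxima agree, so it is enough to compare minima: [X] attains the minimum for [B] and is
   feasible for [F]. *)
by rewrite /width !rmax_twist_loop_twist // leq_sub2l // -cX rmin_le.
Qed.
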